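(* Let $m\ge 2$, $n\ge 1$ and $q_1,\ldots,q_m\ge 1$ be integers, and for each $i=1,\ldots,m$ let $\boldsymbol{A}^{(i)}=[A^{(i)}_{kl}]_{k,l=1}^n\in \mathbb{M}_n(\mathbb{M}_{q_i})$ be positive definite. For $1\le \mu\le n$ let $\boldsymbol{A}^{(i)}_{\mu}=[A^{(i)}_{kl}]_{k,l=1}^{\mu}$ denote the $\mu\times\mu$ leading principal block submatrix of $\boldsymbol{A}^{(i)}$, and let $A^{(i)}_{\mu\mu}$ denote its $\mu$-th diagonal block. Then $$\det\left(\prod_{i=1}^m *\boldsymbol{A}^{(i)}\right)\ \ge\ \prod_{i=1}^m\left(\det \boldsymbol{A}^{(i)}\right)^{\frac{q_1q_2\cdots q_m}{q_i}}\times\prod_{\mu=2}^n\left(\sum_{i=1}^m\left(\frac{\det A^{(i)}_{\mu\mu}\,\det \boldsymbol{A}^{(i)}_{\mu-1}}{\det \boldsymbol{A}^{(i)}_{\mu}}\right)^{\frac{q_1q_2\cdots q_m}{q_i}}-(m-1)\right),$$ where $\prod_{i=1}^m *\boldsymbol{A}^{(i)}$ is the Khatri-Rao product of $\boldsymbol{A}^{(1)},\ldots,\boldsymbol{A}^{(m)}$.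
   Context: All matrices are complex; positive definite means Hermitian positive definite. $\mathbb{M}_q$ is the set of $q\times q$ complex matrices, and $\mathbb{M}_n(\mathbb{M}_q)$ is the set of complex $nq\times nq$ matrices partitioned into $n\times n$ blocks, each block being a $q\times q$ matrix. For matrices $X=[x_{kl}]$ of order $p\times p$ and $Y$, the Kronecker product is the block matrix $X\otimes Y=[x_{kl}Y]_{k,l=1}^{p}$. For $\boldsymbol{A}=[A_{kl}]\in\mathbb{M}_n(\mathbb{M}_p)$ and $\boldsymbol{B}=[B_{kl}]\in\mathbb{M}_n(\mathbb{M}_q)$, the Khatri-Rao product is $\boldsymbol{A}*\boldsymbol{B}:=[A_{kl}\otimes B_{kl}]_{k,l=1}^n\in\mathbb{M}_n(\mathbb{M}_{pq})$. This product is associative, and $\prod_{i=1}^m*\boldsymbol{A}^{(i)}$ denotes $\boldsymbol{A}^{(1)}*\boldsymbol{A}^{(2)}*\cdots*\boldsymbol{A}^{(m)}$, i.e. the block matrix whose $(k,l)$ block is $A^{(1)}_{kl}\otimes\cdots\otimes A^{(m)}_{kl}$. Empty products equal $1$. *)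

(* Defs.v *)
From mathcomp Require Import all_boot all_order all_algebra.
From mathcomp Require Import sesquilinear spectral.
From mathcomp Require Import mxtens.

Set Implicit Arguments.
Unset Strict Implicit.
Unset Printing Implicit Defensive.

Import Order.TTheory GRing.Theory Num.Theory.

Local Open Scope ring_scope.
Local Open Scope sesquilinear_scope.

Definition posdefmx (C : numClosedFieldType) (p : nat) (A : 'M[C]_p) : Prop :=
  A \is hermsymmx /\
  forall x : 'cV[C]_p, x != 0 -> 0 < (x ^t* *m A *m x) 0 0.

(* M_n(M_q).  The order n * q is spelled as a sum over the n blocks, the form
   expected by the library's mxblock and submxblock. *)
Notation blockmx C n q := 'M[C]_(\sum_(k < n) q).

Section BlockMatrices.

Variable C : numClosedFieldType.

Definition blk (n q : nat) (A : blockmx C n q) (k l : 'I_n) : 'M[C]_q :=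
  submxblock A k l.

Definition lead_blockmx (n q : nat) (A : blockmx C n q)
    (mu : nat) (le_mu_n : (mu <= n)%N) : blockmx C mu q :=
  \mxblock_(k < mu, l < mu) blk A (widen_ord le_mu_n k) (widen_ord le_mu_n l).

Definition khatri_rao (n p q : nat)
    (A : blockmx C n p) (B : blockmx C n q) : blockmx C n (p * q) :=
  \mxblock_(k < n, l < n) (blk A k l *t blk B k l).

(* The product of the q i, in a recursive form that makes the types of the
   iterated products match without casts; see kr_dimE. *)
Fixpoint kr_dim (m : nat) : ('I_m -> nat) -> nat :=
  match m return ('I_m -> nat) -> nat with
  | 0 => fun=> 1%N
  | m'.+1 => fun q =>
      (kr_dim (fun i => q (widen_ord (leqnSn m') i)) * q ord_max)%N
  end.

Lemma kr_dimE (m : nat) (q : 'I_m -> nat) : kr_dim q = (\prod_(i < m) q i)%N.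
Proof.
by elim: m q => [|m IHm] q; rewrite ?big_ord0 //= IHm big_ord_recr.
Qed.

(* ((A 0 * A 1) * ...) * A (m - 1).  The empty product is the neutral element
   of the Khatri-Rao product: all blocks are the 1 x 1 matrix 1. *)
Fixpoint khatri_rao_prod (n m : nat) :
    forall q : 'I_m -> nat,
      (forall i, blockmx C n (q i)) -> blockmx C n (kr_dim q) :=
  match m return forall q : 'I_m -> nat,
      (forall i, blockmx C n (q i)) -> blockmx C n (kr_dim q) with
  | 0 => fun _ _ => const_mx 1
  | m'.+1 => fun q A =>
      khatri_rao (khatri_rao_prod (fun i => A (widen_ord (leqnSn m') i)))
                 (A ord_max)
  end.

End BlockMatrices.

(* Main.v *)
(* Peel off the last row and column of blocks.  If S_i is the Schur complement
   of the last diagonal block D_i of A_i, then A_i - (0 (+) S_i) is positive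
   semidefinite, hence so is the Khatri-Rao product of these differences, which
   is the product of the A_i minus 0 (+) X, where X is the Kronecker product of
   the D_i minus that of the Z_i = D_i - S_i.  The last Schur complement of the
   Khatri-Rao product therefore dominates X.  The gap X satisfies a recursion
   in m, X' = E (x) S + X (x) Z with 0 <= X <= E, where E is the Kronecker
   product of the D_i; diagonalizing the pairs (E, X) and (S, Z) by congruence
   turns a lower bound for its determinant into a scalar inequality. *)
Require Import Defs.
From mathcomp Require Import all_boot all_order all_algebra.
From mathcomp Require Import sesquilinear spectral mxtens complex reals ring.

Set Implicit Arguments.
Unset Strict Implicit.
Unset Printing Implicit Defensive.

Import Order.TTheory GRing.Theory Num.Theory.

Local Open Scope ring_scope.
Local Open Scope complex_scope.
Local Open Scope sesquilinear_scope.

(** * Adjoints and determinants of Kronecker products *)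

Lemma trmxC_mul (C : numClosedFieldType) m n p (A : 'M[C]_(m, n)) (B : 'M_(n, p)) :
  (A *m B)^t* = B^t* *m A^t*.
Proof. by rewrite trmx_mul map_mxM. Qed.

Lemma trmxC_tens (C : numClosedFieldType) m n p q
    (A : 'M[C]_(m, n)) (B : 'M[C]_(p, q)) :
  (A *t B)^t* = A^t* *t B^t*.
Proof. by rewrite trmx_tens map_mxT. Qed.

Lemma det_trmxC (C : numClosedFieldType) n (A : 'M[C]_n) : \det (A^t*) = Num.conj (\det A).
Proof. by rewrite det_map_mx det_tr. Qed.

Lemma tensmxDr (R : pzRingType) m n p q (A : 'M[R]_(m, n)) (B B' : 'M[R]_(p, q)) :
  A *t (B + B') = A *t B + A *t B'.
Proof. by apply/matrixP=> i j; rewrite !mxE mulrDr. Qed.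

Lemma tensmx11 (R : pzRingType) m n : 1%:M *t 1%:M = 1%:M :> 'M[R]_(m * n).
Proof.
apply/matrixP=> i j; case: (mxtens_indexP i) => i1 i2; case: (mxtens_indexP j) => j1 j2.
rewrite tensmxE !mxE -natrM mulnb; congr (nat_of_bool _)%:R.
by rewrite -xpair_eqE (inj_eq (can_inj (@mxtens_indexK _ _))).
Qed.

Lemma prod_mxtens (R : comPzRingType) m n (F : 'I_m -> 'I_n -> R) :
  \prod_(k < m * n) F (mxtens_unindex k).1 (mxtens_unindex k).2 =
  \prod_(i < m) \prod_(j < n) F i j.
Proof.
rewrite pair_big (reindex (@mxtens_unindex m n)); last first.
  exists (@mxtens_index m n) => ? _; first exact: mxtens_unindexK.
  exact: mxtens_indexK.
by [].
Qed.

(** Index pairs are ordered lexicographically: above the diagonal either the first row coordinate is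
    the smaller one and [A] vanishes, or the first coordinates agree and [B] vanishes. *)
Lemma is_trig_tensmx (R : pzRingType) m n (A : 'M[R]_m) (B : 'M[R]_n) :
  is_trig_mx A -> is_trig_mx B -> is_trig_mx (A *t B).
Proof.
move=> /is_trig_mxP tA /is_trig_mxP tB; apply/is_trig_mxP => i j.
case: (mxtens_indexP i) => i1 i2; case: (mxtens_indexP j) => j1 j2 lt_ij.
rewrite tensmxE; case: (ltngtP i1 j1) => [lt1|lt1|/val_inj eq1].
- by rewrite tA ?mul0r.
- have lt_ji : (j1 * n + j2 < i1 * n + i2)%N.
    apply: (@leq_trans (j1.+1 * n)%N); first by rewrite mulSn addnC ltn_add2r.
    by apply: (leq_trans _ (leq_addr _ _)); rewrite leq_mul2r lt1 orbT.
  by have := ltn_trans lt_ij lt_ji; rewrite ltnn.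
- by rewrite tB ?mulr0 //; move: lt_ij; rewrite /= eq1 ltn_add2l.
Qed.

Lemma unitary_trig (C : numClosedFieldType) n (A : 'M[C]_n) :
  exists U T : 'M[C]_n, [/\ U^t* *m U = 1%:M, is_trig_mx T & A = U^t* *m T *m U].
Proof.
case: n A => [|n] A.
  by exists 1%:M, 0; split; [apply/matrixP; case| exact: mx0_is_trig | apply/matrixP; case].
have [//|P Pu trigA] := Schur A _.
have PtP : P^t* *m P = 1%:M by rewrite -invmx_unitary // mulVmx // unitarymx_unit.
exists P, (conjmx P A); split=> //.
by rewrite conjymx // !mulmxA PtP mul1mx -mulmxA PtP mulmx1.
Qed.

(** Unitary triangularization of both factors triangularizes the product; each diagonal entry of [T]
    then occurs [n] times and each one of [S] occurs [m] times. *)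
Lemma det_tens (C : numClosedFieldType) m n (A : 'M[C]_m) (B : 'M[C]_n) :
  \det (A *t B) = \det A ^+ n * \det B ^+ m.
Proof.
have [U [T [UU tT ->]]] := unitary_trig A; have [V [S [VV tS ->]]] := unitary_trig B.
rewrite -!tensmx_mul.
have detcancel p (X Y Z : 'M[C]_p) : X *m Z = 1%:M -> \det (X *m Y *m Z) = \det Y.
  by move=> XZ; rewrite !det_mulmx mulrAC -det_mulmx XZ det1 mul1r.
rewrite !detcancel //; last by rewrite tensmx_mul UU VV tensmx11.
rewrite !det_trig ?is_trig_tensmx //.
under eq_bigr do rewrite mxE.
rewrite (prod_mxtens (fun i j => T i i * S j j)).
under eq_bigr do rewrite big_split prodr_const card_ord.
by rewrite big_split prodrXl prodr_const card_ord.
Qed.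

(** * Positive semidefinite matrices *)

(* Gram matrices of arbitrary height: sums are stacked factors, and congruences
   and Kronecker products act on the factor. *)
Definition psdmx (C : numClosedFieldType) n (M : 'M[C]_n) : Prop :=
  exists r (B : 'M[C]_(r, n)), M = B^t* *m B.

Lemma psdmx0 (C : numClosedFieldType) n : psdmx (0 : 'M[C]_n).
Proof. by exists 0, 0; rewrite mulmx0. Qed.

Lemma psdmxD (C : numClosedFieldType) n (M N : 'M[C]_n) :
  psdmx M -> psdmx N -> psdmx (M + N).
Proof.
move=> [r [B ->]] [s [D ->]]; exists (r + s)%N, (col_mx B D).
by rewrite tr_col_mx map_row_mx mul_row_col.
Qed.

Lemma psdmx_cong (C : numClosedFieldType) m n (M : 'M[C]_m) (P : 'M[C]_(m, n)) :
  psdmx M -> psdmx (P^t* *m M *m P).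
Proof.
by move=> [r [B ->]]; exists r, (B *m P); rewrite trmxC_mul !mulmxA.
Qed.

Lemma psdmx_tens (C : numClosedFieldType) m n (M : 'M[C]_m) (N : 'M[C]_n) :
  psdmx M -> psdmx N -> psdmx (M *t N).
Proof.
move=> [r [B ->]] [s [D ->]]; exists (r * s)%N, (B *t D).
by rewrite trmxC_tens tensmx_mul.
Qed.

Lemma psdmx_sub (C : numClosedFieldType) m n (f : 'I_n -> 'I_m) (M : 'M[C]_m) :
  psdmx M -> psdmx (mxsub f f M).
Proof.
move=> [r [B ->]]; exists r, (colsub f B).
by apply/matrixP=> i j; rewrite !mxE; apply: eq_bigr => k _; rewrite !mxE.
Qed.

Lemma psdmx_diag_ge0 (C : numClosedFieldType) n (M : 'M[C]_n) i : psdmx M -> 0 <= M i i.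
Proof.
move=> [r [B ->]]; rewrite mxE sumr_ge0 // => k _.
by rewrite !mxE mulrC mul_conjC_ge0.
Qed.

Lemma psdmx_herm (C : numClosedFieldType) n (M : 'M[C]_n) : psdmx M -> M^t* = M.
Proof. by move=> [r [B ->]]; rewrite trmxC_mul trmxCK. Qed.

Lemma unitary_diag (C : numClosedFieldType) n (M : 'M[C]_n) : M^t* = M ->
  exists U (d : 'rV[C]_n), [/\ U \in unitmx, U *m U^t* = 1%:M & M = U^t* *m diag_mx d *m U].
Proof.
move=> hM; have /hermitian_normalmx /orthomx_spectralP eqM : M \is hermsymmx.
  by rewrite is_hermitianmxE expr0 scale1r hM.
have Uu := spectral_unitarymx M.
exists (spectralmx M), (spectral_diag M); split.
- exact: spectral_unit.
- exact/unitarymxP.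
- by rewrite -invmx_unitary.
Qed.

Lemma diag_mx_factor (C : numClosedFieldType) n (d : 'rV[C]_n) :
  (forall i, 0 <= d 0 i) -> exists P : 'M[C]_n, diag_mx d = P^t* *m P.
Proof.
move=> d_ge0; exists (diag_mx (map_mx sqrtC d)).
rewrite tr_diag_mx map_diag_mx mulmx_diag.
congr (diag_mx _); apply/rowP => i; rewrite !mxE.
by rewrite mulrC -normCK ger0_norm ?sqrtC_ge0 // sqrtCK.
Qed.

Lemma psdmx_factor (C : numClosedFieldType) n (M : 'M[C]_n) :
  psdmx M -> exists P : 'M[C]_n, M = P^t* *m P.
Proof.
move=> psM; have [U [d [_ UU eqM]]] := unitary_diag (psdmx_herm psM).
have [|P eqd] := @diag_mx_factor C n d.
  move=> i; have := psdmx_diag_ge0 i (psdmx_cong (U^t*) psM).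
  by rewrite eqM trmxCK !mulmxA UU mul1mx -mulmxA UU mulmx1 mxE eqxx mulr1n.
by exists (P *m U); rewrite trmxC_mul eqM eqd !mulmxA.
Qed.

(** * Congruence, simultaneous diagonalization, monotonicity of the determinant *)

Lemma det_cong (C : numClosedFieldType) n (P M : 'M[C]_n) :
  \det (P^t* *m M *m P) = `|\det P| ^+ 2 * \det M.
Proof. by rewrite !det_mulmx det_trmxC normCK mulrAC [_^* * _]mulrC. Qed.

Lemma det_psdmx_ge0 (C : numClosedFieldType) n (M : 'M[C]_n) : psdmx M -> 0 <= \det M.
Proof.
move=> /psdmx_factor[P ->]; rewrite -[P^t*]mulmx1 det_cong det1 mulr1.
by rewrite exprn_ge0.
Qed.

Lemma trmxC_inv_mul (C : numClosedFieldType) n (P : 'M[C]_n) :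
  P \in unitmx -> (invmx P)^t* *m P^t* = 1%:M.
Proof. by move=> uP; rewrite -trmxC_mul mulmxV // trmx1 map_mx1. Qed.

Lemma psdmx_cong_diag (C : numClosedFieldType) n (P : 'M[C]_n) (d : 'rV[C]_n) :
  P \in unitmx -> psdmx (P^t* *m diag_mx d *m P) -> forall i, 0 <= d 0 i.
Proof.
move=> uP psd i; have := psdmx_diag_ge0 i (psdmx_cong (invmx P) psd).
rewrite !mulmxA trmxC_inv_mul // mul1mx mulmxK //.
by rewrite mxE eqxx mulr1n.
Qed.

(** Factor [E] through an invertible [Q], pull [X] back along [Q], and diagonalize the resulting
    Hermitian matrix by a unitary [U]; then [U *m Q] serves both. *)
Lemma simul_diag (C : numClosedFieldType) n (E X : 'M[C]_n) :
  psdmx E -> \det E != 0 -> X^t* = X ->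
  exists P (d : 'rV[C]_n),
    [/\ P \in unitmx, E = P^t* *m P & X = P^t* *m diag_mx d *m P].
Proof.
move=> /psdmx_factor[Q eqE] dE hX.
have uQ : Q \in unitmx.
  rewrite unitmxE unitfE; apply: contraNneq dE => dQ.
  by rewrite eqE det_mulmx dQ mulr0.
have hY : ((invmx Q)^t* *m X *m invmx Q)^t* = (invmx Q)^t* *m X *m invmx Q.
  by rewrite !trmxC_mul trmxCK hX mulmxA.
have [U [d [uU UU eqY]]] := unitary_diag hY.
exists (U *m Q), d; split.
- by rewrite unitmx_mul uU uQ.
- rewrite trmxC_mul mulmxA -[_ *m U^t* *m U]mulmxA.
  by rewrite (mulmx1C UU) mulmx1.
- rewrite trmxC_mul !mulmxA -[_ *m U^t* *m _ *m U]mulmxA -[_ *m U^t* *m _]mulmxA.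
  rewrite [U^t* *m _]mulmxA -eqY !mulmxA mulmxKV //.
  by rewrite -trmxC_mul mulVmx // trmx1 map_mx1 mul1mx.
Qed.

(** If [\det X] is nonzero, a common congruence turns [X] into 1 and [Y] into a nonnegative diagonal
    [d], so the determinant grows by the product of the [1 + d i]. *)
Lemma det_psdmx_le (C : numClosedFieldType) n (X Y : 'M[C]_n) :
  psdmx X -> psdmx Y -> \det X <= \det (X + Y).
Proof.
move=> psX psY; have [-> | dX] := eqVneq (\det X) 0.
  exact/det_psdmx_ge0/psdmxD.
have [P [d [uP eqX eqY]]] := simul_diag psX dX (psdmx_herm psY).
have d_ge0 : forall i, 0 <= d 0 i by apply: (psdmx_cong_diag uP); rewrite -eqY.
have {1}-> : X = P^t* *m 1%:M *m P by rewrite mulmx1.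
have -> : X + Y = P^t* *m diag_mx (const_mx 1 + d) *m P.
  by rewrite raddfD /= diag_const_mx mulmxDr mulmxDl mulmx1 -eqX -eqY.
rewrite !det_cong det1 ler_wpM2l ?exprn_ge0 // det_diag.
rewrite -[leLHS](expr1n _ n) -[X in _ ^+ X]card_ord -prodr_const ler_prod // => i _.
by rewrite !mxE ler01 lerDl d_ge0.
Qed.

(** * The scalar inequality and its determinant form *)

Lemma prod_chen (C : numClosedFieldType) (I : finType) (x z : I -> C) :
  (forall i, 0 <= x i <= 1) -> (forall i, 0 <= z i) ->
  1 + \prod_i x i * (\prod_i (1 + z i) - 1) <= \prod_i (1 + x i * z i).
Proof.
move=> x01 z_ge0.
(* The bounds on [a] and [b] are carried along because the inductive step leaves the remainder
   [x z (1 - a) + a (b - 1) (1 - x)], which they make nonnegative. *)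
pose K a b c := [/\ 0 <= a :> C, a <= 1, 1 <= b & 1 + a * (b - 1) <= c].
suff [] : K (\prod_i x i) (\prod_i (1 + z i)) (\prod_i (1 + x i * z i)) by [].
elim/big_rec3: _ => [|i c b a _ [a_ge0 a_le1 b_ge1 le_c]].
  by split; rewrite ?subrr ?mulr0 ?addr0.
have /andP[x_ge0 x_le1] := x01 i; have z_ge := z_ge0 i.
have xz_ge0 := mulr_ge0 x_ge0 z_ge.
split; first exact: mulr_ge0.
- exact: mulr_ile1.
- by rewrite mulr_ege1 // lerDl.
apply: (@le_trans _ _ ((1 + x i * z i) * (1 + a * (b - 1)))); last first.
  by rewrite ler_wpM2l // addr_ge0.
rewrite -subr_ge0.
have -> : (1 + x i * z i) * (1 + a * (b - 1)) - (1 + x i * a * ((1 + z i) * b - 1))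
  = x i * z i * (1 - a) + a * (b - 1) * (1 - x i) by ring.
by rewrite addr_ge0 ?mulr_ge0 ?subr_ge0.
Qed.

(** Congruence by [P *t R] turns [E] and [S] into identities, [X] and [Z] into diagonals [x] and
    [z]. Up to a common factor the claim is then [prod_chen] over all pairs of indices. *)
Lemma det_chen (C : numClosedFieldType) a b (E X : 'M[C]_a) (S Z : 'M[C]_b) :
  psdmx E -> \det E != 0 -> psdmx X -> psdmx (E - X) ->
  psdmx S -> \det S != 0 -> psdmx Z ->
  \det E ^+ b * \det S ^+ a + \det X ^+ b * (\det (S + Z) ^+ a - \det S ^+ a)
    <= \det (E *t S + X *t Z).
Proof.
move=> psE dE psX psEX psS dS psZ.
have [P [x [uP eqE eqX]]] := simul_diag psE dE (psdmx_herm psX).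
have [R [z [uR eqS eqZ]]] := simul_diag psS dS (psdmx_herm psZ).
have x_ge0 : forall i, 0 <= x 0 i by apply: (psdmx_cong_diag uP); rewrite -eqX.
have z_ge0 : forall i, 0 <= z 0 i by apply: (psdmx_cong_diag uR); rewrite -eqZ.
(* [E - X] is congruent to the diagonal matrix of the [1 - x i]. *)
have x_le1 i : x 0 i <= 1.
  have : 0 <= (const_mx 1 - x) 0 i.
    apply: (psdmx_cong_diag uP).
    by rewrite raddfB /= diag_const_mx mulmxBr mulmxBl mulmx1 -eqX -eqE.
  by rewrite !mxE subr_ge0.
have {1}-> : E = P^t* *m 1%:M *m P by rewrite mulmx1.
have -> : S + Z = R^t* *m diag_mx (const_mx 1 + z) *m R.
  by rewrite raddfD /= diag_const_mx mulmxDr mulmxDl mulmx1 -eqS -eqZ.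
have -> : E *t S + X *t Z =
    (P *t R)^t* *m diag_mx (\row_k (1 + x 0 (mxtens_unindex k).1 * z 0 (mxtens_unindex k).2))
      *m (P *t R).
  have -> : diag_mx (\row_k (1 + x 0 (mxtens_unindex k).1 * z 0 (mxtens_unindex k).2))
     = 1%:M *t 1%:M + diag_mx x *t diag_mx z.
    rewrite tensmx11; apply/matrixP=> k l; rewrite !mxE.
    case: (mxtens_indexP k) => k1 k2; case: (mxtens_indexP l) => l1 l2.
    rewrite !mxtens_indexK (can_eq (@mxtens_indexK _ _)) xpair_eqE /=.
    by case: eqP => _; case: eqP => _; rewrite ?mulr0n ?mulr1n ?mul0r ?mulr0 ?addr0.
  rewrite mulmxDr mulmxDl trmxC_tens !tensmx_mul !mulmx1.
  by rewrite -eqE -eqS -eqX -eqZ.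
have {1 2}-> : S = R^t* *m 1%:M *m R by rewrite mulmx1.
rewrite eqX !det_cong det_tens !det_diag !det1 !mulr1.
set p := `|\det P| ^+ 2; set r := `|\det R| ^+ 2.
have -> : `|\det P ^+ b * \det R ^+ a| ^+ 2 = p ^+ b * r ^+ a.
  by rewrite normrM !normrX exprMn -!exprM ![(2 * _)%N]mulnC.
set u := \prod_i x 0 i; set v := \prod_i _; 
have p_ge0 : 0 <= p by rewrite exprn_ge0.
have r_ge0 : 0 <= r by rewrite exprn_ge0.
clearbody p r; rewrite !exprMn.
have -> : p ^+ b * r ^+ a + p ^+ b * u ^+ b * (r ^+ a * v ^+ a - r ^+ a) =
  p ^+ b * r ^+ a * (1 + u ^+ b * (v ^+ a - 1)) by ring.
rewrite ler_wpM2l //; first by rewrite mulr_ge0 ?exprn_ge0.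
under [leRHS]eq_bigr do rewrite mxE.
have := @prod_chen C _ (fun k : 'I_(a * b) => x 0 (mxtens_unindex k).1)
  (fun k => z 0 (mxtens_unindex k).2) _ _.
rewrite (prod_mxtens (fun i _ => x 0 i)) (prod_mxtens (fun _ j => 1 + z 0 j)).
have -> : \prod_(i < a) \prod_(j < b) x 0 i = u ^+ b.
  by rewrite -prodrXl; apply: eq_bigr => i _; rewrite prodr_const card_ord.
have -> : \prod_(i < a) \prod_(j < b) (1 + z 0 j) = v ^+ a.
  rewrite prodr_const card_ord; congr (_ ^+ _).
  by apply: eq_bigr => j _; rewrite !mxE.
apply=> k; last exact: z_ge0.
by rewrite x_ge0 x_le1.
Qed.

(** * Positive definite matrices *)

Lemma posdefmx_psd (C : numClosedFieldType) n (A : 'M[C]_n) :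
  posdefmx A -> psdmx A /\ 0 < \det A.
Proof.
move=> [hA pA].
have hA' : A^t* = A.
  by have := is_hermitianmxP _ _ _ hA; rewrite expr0 scale1r => <-.
have [U [d [uU UU eqA]]] := unitary_diag hA'.
have d_gt0 i : 0 < d 0 i.
  (* The test vector is the unit eigenvector for [d 0 i]. *)
  have := pA (U^t* *m delta_mx i 0) _.
  rewrite trmxC_mul trmxCK {1}eqA !mulmxA -[_ *m U *m U^t*]mulmxA UU mulmx1.
  rewrite -[_ *m U *m U^t*]mulmxA UU mulmx1.
  rewrite trmx_delta map_delta_mx -rowE -[row i _ *m _]colE.
  rewrite [in 0 < _]mxE [in 0 < _]mxE [in 0 < _]mxE eqxx mulr1n; apply.
  apply/negP=> /eqP /(congr1 (mulmx U)); rewrite mulmxA UU mul1mx mulmx0.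
  by move/matrixP=> /(_ i 0); rewrite !mxE !eqxx => /eqP; rewrite oner_eq0.
split.
  have [|P eqd] := @diag_mx_factor C n d; first by move=> i; exact: ltW.
  by exists n, (P *m U); rewrite trmxC_mul eqA eqd !mulmxA.
rewrite eqA det_cong pmulr_rgt0 ?exprn_gt0 ?normr_gt0 -?unitfE -?unitmxE //.
by rewrite det_diag prodr_gt0.
Qed.

Lemma posdefmx_sub (C : numClosedFieldType) m n (f : 'I_n -> 'I_m) (A : 'M[C]_m) :
  injective f -> posdefmx A -> posdefmx (mxsub f f A).
Proof.
move=> inj_f [hA pA].
(* The columns of [F] are orthonormal, so [F] is injective on vectors, and compression by [F] is the
   submatrix. *)
pose F : 'M[C]_(m, n) := colsub f 1%:M.
have FF : F^t* *m F = 1%:M.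
  apply/matrixP=> i j; rewrite !mxE (bigD1 (f i)) //= !mxE eqxx conjC1 mul1r.
  rewrite (inj_eq inj_f) big1 ?addr0 // => k /negPf kf.
  by rewrite !mxE kf conjC0 mul0r.
have -> : mxsub f f A = F^t* *m A *m F.
  rewrite -mulmxA mulmx_colsub mulmx1.
  apply/matrixP=> i j; rewrite !mxE (bigD1 (f i)) //= !mxE eqxx conjC1 mul1r.
  by rewrite big1 ?addr0 // => k /negPf kf; rewrite !mxE kf conjC0 mul0r.
have hA' : A^t* = A.
  by have := is_hermitianmxP _ _ _ hA; rewrite expr0 scale1r => <-.
split.
  by rewrite is_hermitianmxE expr0 scale1r !trmxC_mul trmxCK hA' mulmxA.
move=> x x0; have := pA (F *m x); rewrite trmxC_mul !mulmxA; apply.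
apply: contraNneq x0 => /(congr1 (mulmx (F^t*))).
by rewrite mulmxA FF mul1mx mulmx0 => ->.
Qed.

(** * Schur complements *)

Section SchurComplement.
Variables (C : numClosedFieldType) (a b : nat) (M : 'M[C]_(a + b)).

Definition schur_compl : 'M[C]_b :=
  drsubmx M - dlsubmx M *m invmx (ulsubmx M) *m ursubmx M.

Hypothesis uM : ulsubmx M \in unitmx.

Lemma det_schur_compl : \det M = \det (ulsubmx M) * \det schur_compl.
Proof.
have {1}-> : M = block_mx 1%:M 0 (dlsubmx M *m invmx (ulsubmx M)) 1%:M *m
              block_mx (ulsubmx M) (ursubmx M) 0 schur_compl.
  rewrite mulmx_block !mul1mx !mul0mx !addr0 mulmxKV //.
  by rewrite addrC subrK submxK.
by rewrite det_mulmx det_lblock det_ublock !det1 !mul1r.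
Qed.

(** Block elimination: [M *m V] is [schur_compl] below a zero block. Congruence by [V] leaves a
    matrix supported in the corner with its corner. *)
Let V := col_mx (- (invmx (ulsubmx M) *m ursubmx M)) 1%:M.

Let adjV : V^t* = row_mx ((- (invmx (ulsubmx M) *m ursubmx M))^t*) 1%:M.
Proof. by rewrite tr_col_mx map_row_mx trmx1 map_mx1. Qed.

Lemma schur_compl_cong : V^t* *m M *m V = schur_compl.
Proof.
rewrite -mulmxA -{1}[M]submxK adjV /V mul_block_col !mulmxN !mulmx1 mulKVmx // addNr.
by rewrite mul_row_col mulmx0 add0r mul1mx addrC mulmxA.
Qed.

Lemma corner_cong (X : 'M[C]_b) : V^t* *m block_mx 0 0 0 X *m V = X.
Proof.
rewrite -mulmxA adjV /V mul_block_col !mul0mx !addr0 add0r mulmx1.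
by rewrite mul_row_col mulmx0 add0r mul1mx.
Qed.

Lemma psdmx_schur_compl : psdmx M -> psdmx schur_compl.
Proof. by move=> psM; rewrite -schur_compl_cong; exact: psdmx_cong. Qed.

(** The difference is the congruence of the upper left block by the row of blocks [1] and
    [invmx (ulsubmx M) *m ursubmx M]. *)
Lemma psdmx_sub_corner : psdmx M -> psdmx (M - block_mx 0 0 0 schur_compl).
Proof.
move=> psM; have hM := psdmx_herm psM.
have [hul hur] : (ulsubmx M)^t* = ulsubmx M /\ (ursubmx M)^t* = dlsubmx M.
  by split; apply/matrixP=> i j; rewrite -[in RHS]hM !mxE.
have psul : psdmx (ulsubmx M).
  have := psdmx_cong (col_mx 1%:M 0) psM.
  rewrite -mulmxA -{1}[M]submxK mul_block_col !mulmx0 !addr0 !mulmx1.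
  by rewrite tr_col_mx map_row_mx mul_row_col trmx1 map_mx1 trmx0 map_mx0 mul0mx addr0 mul1mx.
have := psdmx_cong (row_mx 1%:M (invmx (ulsubmx M) *m ursubmx M)) psul.
rewrite tr_row_mx map_col_mx mul_col_mx mul_col_row !mulmx1 trmx1 map_mx1 !mul1mx.
rewrite mulKVmx // trmxC_mul hur.
have -> : (invmx (ulsubmx M))^t* = invmx (ulsubmx M).
  by rewrite trmx_inv map_invmx hul.
rewrite mulmxKV // -{7}[M]submxK opp_block_mx add_block_mx !oppr0 !addr0 opprB.
by rewrite addrC subrK mulmxA.
Qed.

(** Congruence by [V] turns the third hypothesis into positive semidefiniteness of
    [schur_compl - X]; the determinant is monotone. *)
Lemma det_ge_corner (X : 'M[C]_b) : psdmx M -> psdmx X ->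
  psdmx (M - block_mx 0 0 0 X) -> 0 <= \det (ulsubmx M) ->
  \det (ulsubmx M) * \det X <= \det M.
Proof.
move=> psM psX psMX ul_ge0; rewrite det_schur_compl ler_wpM2l //.
rewrite -[schur_compl](subrK X) [_ - X + X]addrC det_psdmx_le //.
rewrite -schur_compl_cong -{1}[X]corner_cong -mulmxBl -mulmxBr.
exact: psdmx_cong.
Qed.

End SchurComplement.

(** * Block indices and splitting off the last block *)

Section Blocks.
Variable C : numClosedFieldType.

Lemma val_Rank n q (k : 'I_n) (i : 'I_q) :
  tagnat.Rank (p_ := fun=> q) k i = (k * q + i)%N :> nat.
Proof.
rewrite tagnat.RankEsum; congr (_ + _)%N.
by rewrite (big_ord_narrow (ltnW (ltn_ord k))) sum_nat_const card_ord.
Qed.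

Lemma blkE n q (A : blockmx C n q) k l i j :
  blk A k l i j = A (tagnat.Rank (p_ := fun=> q) k i) (tagnat.Rank (p_ := fun=> q) l j).
Proof. by rewrite mxE. Qed.

Lemma blockmx_eqP n q (A B : blockmx C n q) :
  (forall k l, blk A k l = blk B k l) -> A = B.
Proof. by move=> eqAB; apply/mxblockP. Qed.

Lemma blk_lead n q (A : blockmx C n q) mu (le_mu : (mu <= n)%N) k l :
  blk (lead_blockmx A le_mu) k l = blk A (widen_ord le_mu k) (widen_ord le_mu l).
Proof. exact: mxblockK. Qed.

Lemma lead_blockmx_sub n q (A : blockmx C n q) mu (le_mu : (mu <= n)%N) :
  exists2 f, injective f & lead_blockmx A le_mu = mxsub f f A.
Proof.
exists (fun s => tagnat.Rank (p_ := fun=> q) (widen_ord le_mu (tagnat.sig1 s)) (tagnat.sig2 s)).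
  move=> s t /(congr1 (@nat_of_ord _)); rewrite !val_Rank => eq_st.
  by rewrite -(tagnat.sig2K s) -(tagnat.sig2K t); apply: ord_inj; rewrite !val_Rank.
by apply/matrixP=> s t; rewrite !mxE.
Qed.

Lemma lead_lead n q (A : blockmx C n q) mu nu (le_mu : (mu <= n)%N) (le_nu : (nu <= mu)%N)
    (le_nun : (nu <= n)%N) :
  lead_blockmx (lead_blockmx A le_mu) le_nu = lead_blockmx A le_nun.
Proof.
apply: blockmx_eqP => k l; rewrite !blk_lead.
by congr blk; apply: val_inj.
Qed.

Lemma lead_blockmx_full n q (A : blockmx C n q) (le_nn : (n <= n)%N) :
  lead_blockmx A le_nn = A.
Proof.
by apply: blockmx_eqP => k l; rewrite blk_lead; congr blk; apply: val_inj.
Qed.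

Lemma block_dim_recr n q : (\sum_(k < n.+1) q = \sum_(k < n) q + q)%N.
Proof. exact: big_ord_recr. Qed.

(** The cast exposes the order as a sum of two terms, the form on which [ulsubmx] and [schur_compl]
    act. *)
Definition split_last n q (A : blockmx C n.+1 q) : 'M[C]_(\sum_(k < n) q + q) :=
  castmx (block_dim_recr n q, block_dim_recr n q) A.

Lemma split_lastE n q (A : blockmx C n.+1 q) s t :
  split_last A s t =
  A (cast_ord (esym (block_dim_recr n q)) s) (cast_ord (esym (block_dim_recr n q)) t).
Proof. exact: castmxE. Qed.

Lemma det_split_last n q (A : blockmx C n.+1 q) : \det (split_last A) = \det A.
Proof. by rewrite /split_last; case: _ / (block_dim_recr n q). Qed.

Lemma psdmx_split_last n q (A : blockmx C n.+1 q) : psdmx (split_last A) <-> psdmx A.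
Proof. by rewrite /split_last; case: _ / (block_dim_recr n q). Qed.

Lemma split_lastB n q (A B : blockmx C n.+1 q) :
  split_last (A - B) = split_last A - split_last B.
Proof. by rewrite /split_last; case: _ / (block_dim_recr n q). Qed.

Lemma cast_lshift_Rank n q (s : 'I_(\sum_(k < n) q)) :
  cast_ord (esym (block_dim_recr n q)) (lshift q s) =
  tagnat.Rank (p_ := fun=> q) (widen_ord (leqnSn n) (tagnat.sig1 s)) (tagnat.sig2 s).
Proof.
by apply: ord_inj; rewrite val_Rank /= -[in LHS](tagnat.sig2K s) val_Rank.
Qed.

Lemma cast_rshift_Rank n q (j : 'I_q) :
  cast_ord (esym (block_dim_recr n q)) (rshift _ j) =
  tagnat.Rank (p_ := fun=> q) ord_max j.
Proof.
by apply: ord_inj; rewrite val_Rank /= sum_nat_const card_ord.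
Qed.

Lemma ulsubmx_split_last n q (A : blockmx C n.+1 q) :
  ulsubmx (split_last A) = lead_blockmx A (leqnSn n).
Proof.
apply/matrixP=> s t; rewrite !mxE split_lastE !cast_lshift_Rank.
by rewrite -blkE.
Qed.

Lemma drsubmx_split_last n q (A : blockmx C n.+1 q) :
  drsubmx (split_last A) = blk A ord_max ord_max.
Proof.
by apply/matrixP=> i j; rewrite !mxE split_lastE !cast_rshift_Rank.
Qed.

Definition cornermx n q (S : 'M[C]_q) : blockmx C n.+1 q :=
  \mxblock_(k < n.+1, l < n.+1) (if (k == ord_max) && (l == ord_max) then S else 0).

Lemma widen_neq_max n (k : 'I_n) : (widen_ord (leqnSn n) k == ord_max) = false.
Proof. by apply/eqP => /(congr1 val) /= eqk; have := ltn_ord k; rewrite eqk ltnn. Qed.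

Lemma split_last_corner n q (S : 'M[C]_q) :
  split_last (cornermx n S) = block_mx 0 0 0 S.
Proof.
apply/matrixP=> s t; rewrite split_lastE.
rewrite -(splitK s) -(splitK t); case: (split s) => s'; case: (split t) => t' /=;
rewrite ?block_mxEul ?block_mxEur ?block_mxEdl ?block_mxEdr
  ?cast_lshift_Rank ?cast_rshift_Rank -blkE /blk mxblockK ?widen_neq_max ?eqxx ?andbF ?mxE //.
Qed.

End Blocks.

(** * Khatri-Rao products and iterated Kronecker products *)

Lemma psdmx_khatri_rao (C : numClosedFieldType) n p q
    (A : blockmx C n p) (B : blockmx C n q) :
  psdmx A -> psdmx B -> psdmx (khatri_rao A B).
Proof.
move=> psA psB.
(* The Khatri-Rao product is the principal submatrix of the Kronecker product on the pairs of
   indices from equally numbered blocks. *)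
pose f (s : 'I_(\sum_(k < n) p * q)) : 'I_((\sum_(k < n) p) * (\sum_(k < n) q)) :=
  let k := tagnat.sig1 s in let ij := mxtens_unindex (tagnat.sig2 s) in
  mxtens_index (tagnat.Rank (p_ := fun=> p) k ij.1, tagnat.Rank (p_ := fun=> q) k ij.2).
have -> : khatri_rao A B = mxsub f f (A *t B).
  by apply/matrixP=> s t; rewrite [RHS]mxE tensmxE !mxE.
exact/psdmx_sub/psdmx_tens.
Qed.

Lemma psdmx_khatri_rao_prod (C : numClosedFieldType) n m (q : 'I_m -> nat)
    (A : forall i, blockmx C n (q i)) :
  (forall i, psdmx (A i)) -> psdmx (khatri_rao_prod A).
Proof.
elim: m q A => [|m IHm] q A psA /=; last by apply: psdmx_khatri_rao => //; exact: IHm.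
exists 1, (const_mx 1); apply/matrixP=> i j.
by rewrite !mxE big_ord1 !mxE conjC1 mul1r.
Qed.

(** The recursion mirrors [khatri_rao_prod], so blocks of the latter have this type without
    casts. *)
Fixpoint tens_prod (C : numClosedFieldType) m :
    forall q : 'I_m -> nat, (forall i, 'M[C]_(q i)) -> 'M[C]_(kr_dim q) :=
  match m return forall q : 'I_m -> nat,
      (forall i, 'M[C]_(q i)) -> 'M[C]_(kr_dim q) with
  | 0 => fun _ _ => const_mx 1
  | m'.+1 => fun q D =>
      tens_prod (fun i => D (widen_ord (leqnSn m') i)) *t D ord_max
  end.

Lemma eq_tens_prod (C : numClosedFieldType) m (q : 'I_m -> nat) (D D' : forall i, 'M[C]_(q i)) :
  (forall i, D i = D' i) -> tens_prod D = tens_prod D'.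
Proof.
elim: m q D D' => [|m IHm] q D D' eqD //=.
by rewrite eqD; congr (_ *t _); apply: IHm => i; rewrite eqD.
Qed.

Lemma blk_khatri_rao_prod (C : numClosedFieldType) n m (q : 'I_m -> nat)
    (A : forall i, blockmx C n (q i)) k l :
  blk (khatri_rao_prod A) k l = tens_prod (fun i => blk (A i) k l).
Proof.
elim: m q A => [|m IHm] q A /=; first by apply/matrixP=> i j; rewrite !mxE.
by rewrite -IHm; exact: mxblockK.
Qed.

Lemma psdmx_tens_prod (C : numClosedFieldType) m (q : 'I_m -> nat) (D : forall i, 'M[C]_(q i)) :
  (forall i, psdmx (D i)) -> psdmx (tens_prod D).
Proof.
elim: m q D => [|m IHm] q D psD /=; last by apply: psdmx_tens => //; apply: IHm.
by exists 1, 1%:M; apply/matrixP=> i j; rewrite !ord1 mulmx1 !mxE eqxx conjC1.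
Qed.

(** * Exponents and a scalar bound for products *)

Definition wt m (q : 'I_m -> nat) (i : 'I_m) := ((\prod_(j < m) q j) %/ q i)%N.

Lemma wt_widen m (q : 'I_m.+1 -> nat) i : (0 < q (widen_ord (leqnSn m) i))%N ->
  wt q (widen_ord (leqnSn m) i) = (wt (fun i => q (widen_ord (leqnSn m) i)) i * q ord_max)%N.
Proof.
move=> q_gt0; rewrite /wt big_ord_recr /= (bigD1 i) //=.
by rewrite -mulnA !mulKn.
Qed.

Lemma wt_max m (q : 'I_m.+1 -> nat) : (0 < q ord_max)%N ->
  wt q ord_max = kr_dim (fun i => q (widen_ord (leqnSn m) i)).
Proof. by move=> q_gt0; rewrite /wt big_ord_recr mulnK // kr_dimE. Qed.

Lemma wt_prod_recr (C : numClosedFieldType) m (q : 'I_m.+1 -> nat) (x : 'I_m.+1 -> C) :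
  (forall i, 0 < q i)%N ->
  \prod_(i < m.+1) x i ^+ wt q i =
  (\prod_(i < m) x (widen_ord (leqnSn m) i) ^+ wt (fun i => q (widen_ord (leqnSn m) i)) i)
    ^+ q ord_max * x ord_max ^+ kr_dim (fun i => q (widen_ord (leqnSn m) i)).
Proof.
move=> q_gt0; rewrite big_ord_recr /= wt_max // -prodrXl; congr (_ * _).
by apply: eq_bigr => i _; rewrite wt_widen // exprM.
Qed.

Lemma det_tens_prod (C : numClosedFieldType) m (q : 'I_m -> nat) (D : forall i, 'M[C]_(q i)) :
  (forall i, 0 < q i)%N -> \det (tens_prod D) = \prod_i \det (D i) ^+ wt q i.
Proof.
elim: m q D => [|m IHm] q D q_gt0 /=; first by rewrite big_ord0 det_mx11 mxE.
by rewrite det_tens IHm // wt_prod_recr.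
Qed.

(** By induction: with [p >= 1] the product so far and [w >= 1] a new factor, [p w] exceeds
    [p + (w - 1)] by [(p - 1) (w - 1)]. *)
Lemma prod_ge_sum (C : numClosedFieldType) m (w : 'I_m -> C) :
  (forall i, 1 <= w i) -> \sum_i w i - (m%:R - 1) <= \prod_i w i.
Proof.
elim: m w => [|m IHm] w w_ge1; first by rewrite !big_ord0 sub0r opprB subr0.
rewrite !big_ord_recr /=; set w0 := fun i : 'I_m => w (widen_ord (leqnSn m) i).
have w0_ge1 i : 1 <= w0 i by exact: w_ge1.
have p_ge1 : 1 <= \prod_i w0 i.
  by elim/big_ind: _ => // x y; exact: mulr_ege1.
have := IHm w0 w0_ge1; rewrite -/w0.
set s := \sum_(i < m) w0 i; set p := \prod_(i < m) w0 i; move=> le_sp.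
have -> : s + w ord_max - (m.+1%:R - 1) = s - (m%:R - 1) + (w ord_max - 1).
  by rewrite -natr1; ring.
apply: (@le_trans _ _ (p + (w ord_max - 1))); first by rewrite lerD2r.
rewrite -subr_ge0 (_ : _ - _ = (p - 1) * (w ord_max - 1)); last by ring.
by rewrite mulr_ge0 ?subr_ge0.
Qed.

(** * The gap between two Kronecker products *)

(* The gap [tens_prod (S + Z) - tens_prod Z] is the part of the last diagonal
   block of a Khatri-Rao product that lies above its singular part, when [S i]
   and [S i + Z i] are the last Schur complement and diagonal block of the i-th
   factor. *)
Section Gap.
Variables (C : numClosedFieldType).

Definition tens_gap m (q : 'I_m -> nat) (S Z : forall i, 'M[C]_(q i)) :=
  tens_prod (fun i => S i + Z i) - tens_prod Z.

Lemma tens_gap_recr m (q : 'I_m.+1 -> nat) (S Z : forall i, 'M[C]_(q i)) :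
  let w := widen_ord (leqnSn m) in
  tens_gap S Z =
  tens_prod (fun i => S (w i) + Z (w i)) *t S ord_max +
  tens_gap (fun i => S (w i)) (fun i => Z (w i)) *t Z ord_max.
Proof.
rewrite /tens_gap /= tensmxDr -addrA; congr (_ + _).
by apply/matrixP=> i j; rewrite !mxE mulrBl.
Qed.

Lemma psdmx_tens_gap m (q : 'I_m -> nat) (S Z : forall i, 'M[C]_(q i)) :
  (forall i, psdmx (S i)) -> (forall i, psdmx (Z i)) -> psdmx (tens_gap S Z).
Proof.
elim: m q S Z => [|m IHm] q S Z psS psZ; first by rewrite /tens_gap subrr; exact: psdmx0.
rewrite tens_gap_recr; apply: psdmxD; apply: psdmx_tens => //; last exact: IHm.
by apply: psdmx_tens_prod => i; apply: psdmxD.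
Qed.

End Gap.

(** This is [det_chen] with [E] the product of the first [m] matrices [S i + Z i] and [X] their gap;
    [E - X] is the product of the [Z i]. *)
Lemma det_tens_gap_recr (C : numClosedFieldType) m (q : 'I_m.+1 -> nat)
    (S Z : forall i, 'M[C]_(q i)) :
  let w := widen_ord (leqnSn m) in let Q := kr_dim (fun i => q (w i)) in
  (forall i, 0 < q i)%N -> (forall i, psdmx (S i)) ->
  (forall i, 0 < \det (S i)) -> (forall i, psdmx (Z i)) ->
  (\prod_(i < m) \det (S (w i) + Z (w i)) ^+ wt (fun i => q (w i)) i) ^+ q ord_max
     * \det (S ord_max) ^+ Q
  + \det (tens_gap (fun i => S (w i)) (fun i => Z (w i))) ^+ q ord_max
     * (\det (S ord_max + Z ord_max) ^+ Q - \det (S ord_max) ^+ Q)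
  <= \det (tens_gap S Z).
Proof.
move=> w Q q_gt0 psS dS psZ; rewrite tens_gap_recr.
have dD i : 0 < \det (S i + Z i) by apply: lt_le_trans (dS i) (det_psdmx_le _ _).
rewrite -det_tens_prod //; apply: det_chen => //.
- by apply: psdmx_tens_prod => i; apply: psdmxD.
- by rewrite gt_eqF // det_tens_prod // prodr_gt0 // => i _; rewrite exprn_gt0.
- exact: psdmx_tens_gap.
- by rewrite /tens_gap subKr; exact: psdmx_tens_prod.
- by rewrite gt_eqF.
Qed.

(** Drop the nonnegative second term of the recursion and bound each [\det (S i + Z i)] below by
    [\det (S i)]. The case of a single factor is included, so the bound applies to the smaller gap
    in [det_tens_gap]. *)
Lemma det_tens_gap_weak (C : numClosedFieldType) m (q : 'I_m -> nat)
    (S Z : forall i, 'M[C]_(q i)) :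
  (0 < m)%N -> (forall i, 0 < q i)%N -> (forall i, psdmx (S i)) ->
  (forall i, 0 < \det (S i)) -> (forall i, psdmx (Z i)) ->
  \prod_i \det (S i) ^+ wt q i <= \det (tens_gap S Z).
Proof.
case: m q S Z => // m q S Z _ q_gt0 psS dS psZ.
have leD i : \det (S i) <= \det (S i + Z i) by exact: det_psdmx_le.
have ge0 i := ltW (dS i); have geD i := le_trans (ge0 i) (leD i).
apply: le_trans (det_tens_gap_recr q_gt0 psS dS psZ); rewrite wt_prod_recr //.
rewrite -[leLHS]addr0 lerD //.
  rewrite ler_wpM2r ?exprn_ge0 // lerXn2r ?nnegrE ?prodr_ge0 // => [i _|i _|].
  - by rewrite exprn_ge0.
  - by rewrite exprn_ge0 // geD.
  by apply: ler_prod => i _; rewrite exprn_ge0 //= lerXn2r ?nnegrE ?geD.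
rewrite mulr_ge0 ?exprn_ge0 //.
  by apply/det_psdmx_ge0/psdmx_tens_gap.
by rewrite subr_ge0 lerXn2r ?nnegrE ?geD.
Qed.

Lemma det_tens_gap (C : numClosedFieldType) m (q : 'I_m -> nat)
    (S Z : forall i, 'M[C]_(q i)) :
  (1 < m)%N -> (forall i, 0 < q i)%N -> (forall i, psdmx (S i)) ->
  (forall i, 0 < \det (S i)) -> (forall i, psdmx (Z i)) ->
  (\prod_i \det (S i) ^+ wt q i) *
    (\sum_i (\det (S i + Z i) / \det (S i)) ^+ wt q i - (m%:R - 1))
    <= \det (tens_gap S Z).
Proof.
(* From here [m] counts the factors before the last, and there is at least one. *)
case: m q S Z => // m q S Z m_gt0 q_gt0 psS dS psZ.
have leD i : \det (S i) <= \det (S i + Z i) by exact: det_psdmx_le.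
have ge0 i := ltW (dS i).
apply: le_trans (det_tens_gap_recr q_gt0 psS dS psZ).
pose r i := \det (S i + Z i) / \det (S i).
have r_ge1 i : 1 <= r i by rewrite ler_pdivlMr // mul1r.
have eqD i : \det (S i + Z i) = r i * \det (S i) by rewrite divfK // gt_eqF.
pose w := widen_ord (leqnSn m); set Q := kr_dim _.
pose s := \prod_(i < m) \det (S (w i)) ^+ wt (fun i => q (w i)) i.
have s_gt0 : 0 < s by apply: prodr_gt0 => i _; rewrite exprn_gt0.
pose t := \det (S ord_max) ^+ Q.
pose p := (\prod_(i < m) r (w i) ^+ wt (fun i => q (w i)) i) ^+ q ord_max.
rewrite wt_prod_recr // -/s -/t.
have -> : (\prod_(i < m) \det (S (w i) + Z (w i)) ^+ wt (fun i => q (w i)) i) ^+ q ord_max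
     = p * s ^+ q ord_max.
  rewrite -exprMn -big_split; congr (_ ^+ _).
  by apply: eq_bigr => i _; rewrite eqD exprMn.
rewrite [\det (S ord_max + _)]eqD exprMn -/t.
(* The weak bound replaces the determinant of the smaller gap by [s]. Dividing by the powers of the
   [\det (S i)] leaves [p + (r ord_max ^+ Q - 1)], and [prod_ge_sum] bounds [p]. *)
apply: (@le_trans _ _ (p * s ^+ q ord_max * t + s ^+ q ord_max * (r ord_max ^+ Q * t - t))).
  have -> : p * s ^+ q ord_max * t + s ^+ q ord_max * (r ord_max ^+ Q * t - t) =
     s ^+ q ord_max * t * (p + (r ord_max ^+ Q - 1)) by ring.
  rewrite ler_wpM2l ?mulr_ge0 ?exprn_ge0 ?(ltW s_gt0) //.
  rewrite big_ord_recr /= wt_max // -/Q -/(r ord_max) -natr1 addrK.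
  have := @prod_ge_sum C m (fun i => r (w i) ^+ wt q (w i)) _.
  have -> : \prod_(i < m) r (w i) ^+ wt q (w i) = p.
    by rewrite /p -prodrXl; apply: eq_bigr => i _; rewrite wt_widen // exprM.
  move=> le_p; rewrite addrAC [leRHS]addrA -subr_ge0.
  rewrite (_ : _ - _ = p - (\sum_(i < m) r (w i) ^+ wt q (w i) - (m%:R - 1))); last by rewrite -/w; ring.
  by rewrite subr_ge0 le_p // => i; rewrite exprn_ege1.
rewrite lerD2l ler_wpM2r //.
  rewrite subr_ge0 ler_peMl ?exprn_ge0 // exprn_ege1 //.
rewrite lerXn2r ?nnegrE ?(ltW s_gt0) //; first exact/det_psdmx_ge0/psdmx_tens_gap.
exact: det_tens_gap_weak.
Qed.

(** * Removing corners from a Khatri-Rao product *)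

Lemma blkB (C : numClosedFieldType) n q (A B : blockmx C n q) k l :
  blk (A - B) k l = blk A k l - blk B k l.
Proof. exact: submxblockB. Qed.

(** Only the last diagonal block changes: each factor becomes [Z i] there, and the product of the
    [Z i] is that of the [S i + Z i] minus the gap. *)
Lemma khatri_rao_prod_sub_corner (C : numClosedFieldType) n m (q : 'I_m -> nat)
    (A : forall i, blockmx C n.+1 (q i)) (S Z : forall i, 'M[C]_(q i)) :
  (forall i, blk (A i) ord_max ord_max = S i + Z i) ->
  khatri_rao_prod (fun i => A i - cornermx n (S i)) =
  khatri_rao_prod A - cornermx n (tens_gap S Z).
Proof.
move=> eqSZ; apply: blockmx_eqP => k l.
rewrite blkB !blk_khatri_rao_prod [X in _ - X]mxblockK.
case: ifP => [/andP[/eqP-> /eqP->]|nkl].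
  rewrite /tens_gap (eq_tens_prod eqSZ) subKr; apply: eq_tens_prod => i.
  by rewrite blkB eqSZ [X in _ - X]mxblockK !eqxx addrC addKr.
rewrite subr0; apply: eq_tens_prod => i.
by rewrite blkB [X in _ - X]mxblockK nkl subr0.
Qed.

Lemma lead_khatri_rao_prod (C : numClosedFieldType) n m (q : 'I_m -> nat)
    (A : forall i, blockmx C n (q i)) mu (le_mu : (mu <= n)%N) :
  lead_blockmx (khatri_rao_prod A) le_mu = khatri_rao_prod (fun i => lead_blockmx (A i) le_mu).
Proof.
apply: blockmx_eqP => k l; rewrite blk_lead !blk_khatri_rao_prod.
by apply: eq_tens_prod => i; rewrite blk_lead.
Qed.

Lemma det_dim0 (R : comPzRingType) n (A : 'M[R]_n) : n = 0 -> \det A = 1.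
Proof. by move=> n0; move: A; rewrite n0 => A; exact: det_mx00. Qed.

(** * Induction on the number of blocks *)

Section Main.
Variables (C : numClosedFieldType) (m : nat) (q : 'I_m -> nat).
Hypotheses (m_gt1 : (1 < m)%N) (q_gt0 : forall i, (0 < q i)%N).

Definition chen_factor n (A : forall i, blockmx C n (q i)) (mu : 'I_n) : C :=
  \sum_i (\det (blk (A i) mu mu) * \det (lead_blockmx (A i) (ltnW (ltn_ord mu)))
            / \det (lead_blockmx (A i) (ltn_ord mu))) ^+ wt q i - (m%:R - 1).

Lemma posdefmx_lead n p (A : blockmx C n p) mu (le_mu : (mu <= n)%N) :
  posdefmx A -> posdefmx (lead_blockmx A le_mu).
Proof. by have [f injf ->] := lead_blockmx_sub A le_mu; exact: posdefmx_sub. Qed.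

Lemma chen_factor_lead n (A : forall i, blockmx C n.+1 (q i)) (mu : 'I_n) :
  chen_factor (fun i => lead_blockmx (A i) (leqnSn n)) mu =
  chen_factor A (widen_ord (leqnSn n) mu).
Proof.
rewrite /chen_factor; congr (_ - _); apply: eq_bigr => i _; congr (_ ^+ _).
pose w_mu := ltn_ord (widen_ord (leqnSn n) mu).
by rewrite blk_lead (lead_lead _ _ _ (ltnW w_mu)) (lead_lead _ _ _ w_mu).
Qed.

(** Here [d] is the determinant of the gap. The bound with [chen_factor] contributes the new factor;
    the one without it makes [d] positive and serves when the last block is also the first. *)
Lemma det_khatri_rao_prod_step n (A : forall i, blockmx C n.+1 (q i)) :
  (forall i, posdefmx (A i)) ->
  let L i := lead_blockmx (A i) (leqnSn n) in
  0 < \det (khatri_rao_prod L) ->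
  exists2 d, \det (khatri_rao_prod L) * d <= \det (khatri_rao_prod A)
    & [/\ 0 <= chen_factor A ord_max,
          \prod_i (\det (A i) / \det (L i)) ^+ wt q i <= d &
          (\prod_i (\det (A i) / \det (L i)) ^+ wt q i) * chen_factor A ord_max <= d].
Proof.
move=> pdA L detL_gt0.
have psA i : psdmx (A i) by case: (posdefmx_psd (pdA i)).
have dA i : 0 < \det (A i) by case: (posdefmx_psd (pdA i)).
have dL i : 0 < \det (L i) by case: (posdefmx_psd (posdefmx_lead (leqnSn n) (pdA i))).
pose M i := split_last (A i).
have ulM i : ulsubmx (M i) = L i by exact: ulsubmx_split_last.
have uM i : ulsubmx (M i) \in unitmx by rewrite ulM unitmxE unitfE gt_eqF.
have psM i : psdmx (M i) by apply/psdmx_split_last.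
pose S i := schur_compl (M i); pose Z i := blk (A i) ord_max ord_max - S i.
have detS i : \det (A i) = \det (L i) * \det (S i).
  by rewrite -ulM -det_schur_compl // det_split_last.
have psS i : psdmx (S i) by exact: psdmx_schur_compl.
have eqSZ i : blk (A i) ord_max ord_max = S i + Z i by rewrite addrC subrK.
have psMS i : psdmx (M i - block_mx 0 0 0 (S i)) by exact: psdmx_sub_corner.
(* [Z i] is the last diagonal block of the positive semidefinite matrix in [psMS]. *)
have psZ i : psdmx (Z i).
  have := psdmx_sub (@rshift _ _) (psMS i); congr psdmx.
  by apply/matrixP=> k l; rewrite mxE [LHS]mxE [X in _ + X]mxE block_mxEdr /Z -drsubmx_split_last !mxE.
have dS i : 0 < \det (S i) by rewrite -(pmulr_rgt0 _ (dL i)) -detS.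
have divS i : \det (A i) / \det (L i) = \det (S i).
  by rewrite detS mulrC mulKf // gt_eqF.
exists (\det (tens_gap S Z)).
  rewrite -(det_split_last (khatri_rao_prod A)) -lead_khatri_rao_prod -ulsubmx_split_last.
  have ulG : ulsubmx (split_last (khatri_rao_prod A)) = khatri_rao_prod L.
    by rewrite ulsubmx_split_last lead_khatri_rao_prod.
  apply: det_ge_corner.
  - by rewrite ulG unitmxE unitfE gt_eqF.
  - by apply/psdmx_split_last; exact: psdmx_khatri_rao_prod.
  - exact: psdmx_tens_gap.
  - rewrite -split_last_corner -split_lastB -(khatri_rao_prod_sub_corner eqSZ).
    apply/psdmx_split_last/psdmx_khatri_rao_prod => i.
    by apply/psdmx_split_last; rewrite split_lastB split_last_corner.
  - by rewrite ulG ltW.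
under eq_bigr do rewrite divS.
have -> : chen_factor A ord_max =
    \sum_i (\det (S i + Z i) / \det (S i)) ^+ wt q i - (m%:R - 1).
  rewrite /chen_factor; congr (_ - _); apply: eq_bigr => i _; congr (_ ^+ _).
  rewrite eqSZ lead_blockmx_full (_ : lead_blockmx _ _ = L i); last first.
    by congr lead_blockmx; apply: bool_irrelevance.
  by rewrite -divS invf_div mulrA.
split; last exact: det_tens_gap.
  (* Each ratio is at least 1, so the sum is at least [m]. *)
  rewrite subr_ge0 (@le_trans _ _ m%:R) ?gerBl //.
  rewrite -[X in X%:R]card_ord -sumr_const ler_sum // => i _.
  by rewrite exprn_ege1 // ler_pdivlMr // mul1r det_psdmx_le.
by apply: det_tens_gap_weak => //; apply: ltnW.
Qed.

(** Positivity of the determinant makes the upper left block invertible in the next step;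
    nonnegativity of the factors lets the inequalities be multiplied. *)
Lemma det_khatri_rao_prod_ge n (A : forall i, blockmx C n (q i)) :
  (forall i, posdefmx (A i)) ->
  [/\ 0 < \det (khatri_rao_prod A),
      0 <= \prod_(mu < n | (0 < mu)%N) chen_factor A mu &
      (\prod_i \det (A i) ^+ wt q i) * \prod_(mu < n | (0 < mu)%N) chen_factor A mu
        <= \det (khatri_rao_prod A)].
Proof.
elim: n A => [|n IHn] A pdA.
  rewrite det_dim0 ?big_ord0 // mulr1 big1 // ?ltr01 ?ler01 // => i _.
  by rewrite det_dim0 ?big_ord0 // expr1n.
have dA i : 0 < \det (A i) by case: (posdefmx_psd (pdA i)).
pose L i := lead_blockmx (A i) (leqnSn n).
have pdL i : posdefmx (L i) by exact: posdefmx_lead.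
have dL i : 0 < \det (L i) by case: (posdefmx_psd (pdL i)).
have [G_gt0 lf0_ge0 leG] := IHn L pdL.
have [d le_d [lf_ge0 weak strong]] := det_khatri_rao_prod_step pdA G_gt0.
set s := \prod_i _ in weak strong.
have s_gt0 : 0 < s by apply: prodr_gt0 => i _; rewrite exprn_gt0 // divr_gt0.
have d_gt0 : 0 < d by exact: lt_le_trans weak.
(* Index 0 is left out of the product, so for [n = 0] the new factor is 1 and the bound [weak] takes
   over. *)
have eq_lf : \prod_(mu < n.+1 | (0 < mu)%N) chen_factor A mu =
    (\prod_(mu < n | (0 < mu)%N) chen_factor L mu) *
    (if (0 < n)%N then chen_factor A ord_max else 1).
  rewrite big_mkcond big_ord_recr /= -big_mkcond /=; congr (_ * _).
  by apply: eq_bigr => mu _; rewrite -chen_factor_lead.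
have if_ge0 : 0 <= if (0 < n)%N then chen_factor A ord_max else 1 by case: ifP.
rewrite eq_lf; split; first by apply: lt_le_trans le_d; rewrite mulr_gt0.
  by rewrite mulr_ge0.
apply: le_trans le_d.
have -> : \prod_i \det (A i) ^+ wt q i = (\prod_i \det (L i) ^+ wt q i) * s.
  rewrite -big_split; apply: eq_bigr => i _.
  by rewrite /= -exprMn mulrC divfK // gt_eqF.
rewrite mulrACA ler_pM //.
- by rewrite mulr_ge0 // prodr_ge0 // => i _; rewrite exprn_ge0 // ltW.
- by rewrite mulr_ge0 ?(ltW s_gt0).
by case: ifP => // _; rewrite mulr1.
Qed.

End Main.

Local Close Scope sesquilinear_scope.

(* Indices are 0-based: mu : 'I_n stands for mu + 1 in the usual numbering, so
   lead_blockmx at (ltn_ord mu) has mu + 1 diagonal blocks, the last of which is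
   blk (A i) mu mu, and lead_blockmx at (ltnW (ltn_ord mu)) has mu of them.
   In the order of R[i], x <= y means that y - x is a nonnegative real. *)
Theorem theorem2p5 (R : realType) (m n : nat) (q : 'I_m -> nat)
    (A : forall i : 'I_m, blockmx (R[i] : numClosedFieldType) n (q i))
    (hm : (2 <= m)%N) (hn : (1 <= n)%N) (hq : forall i, (1 <= q i)%N)
    (hA : forall i, posdefmx (A i)) :
  \det (khatri_rao_prod A) >=
    (\prod_(i < m) \det (A i) ^+ ((\prod_(j < m) q j) %/ q i)) *
    \prod_(mu < n | (0 < mu)%N)
      (\sum_(i < m)
         (\det (blk (A i) mu mu) * \det (lead_blockmx (A i) (ltnW (ltn_ord mu)))
            / \det (lead_blockmx (A i) (ltn_ord mu)))
           ^+ ((\prod_(j < m) q j) %/ q i)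
       - (m%:R - 1)).
Proof.
by have [] := det_khatri_rao_prod_ge hm hq hA.
Qed.
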